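(* The following seven classes of graphs coincide: the $\mathcal{U}^{++}$-graphs, the $\mathcal{U}^{++,+-}$-graphs, the $\mathcal{U}^{++,-+}$-graphs, the $\mathcal{U}^{--,+-}$-graphs, the $\mathcal{U}^{--,-+}$-graphs, the $\mathcal{U}^{++,+-,-+}$-graphs and the $\mathcal{U}^{--,+-,-+}$-graphs.
   Context: All graphs are finite, simple and undirected. For real $x$, a unit interval is one of $[x,x+1]$ (closed), $(x,x+1)$ (open), $(x,x+1]$ (open-closed) or $[x,x+1)$ (closed-open). Let $\mathcal{U}^{++}$, $\mathcal{U}^{--}$, $\mathcal{U}^{-+}$, $\mathcal{U}^{+-}$ denote respectively the sets of all closed, open, open-closed and closed-open unit intervals, and for a set of these symbols, e.g. $\mathcal{U}^{++,+-}=\mathcal{U}^{++}\cup\mathcal{U}^{+-}$, denote the union of the corresponding sets. For a family $\mathcal{N}$ of intervals, a graph $G$ is an $\mathcal{N}$-graph if there is a map $I:V(G)\to\mathcal{N}$ such that for any two distinct vertices $u,v$, $u$ and $v$ are adjacent if and only if $I(u)\cap I(v)\neq\emptyset$. *)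

(* Defs.v *)
From HB Require Import structures.
From mathcomp Require Export all_boot all_order all_algebra.
From mathcomp Require Export mathcomp_extra boolp classical_sets set_interval reals.
Set Implicit Arguments.
Unset Strict Implicit.
Unset Printing Implicit Defensive.

Import Order.TTheory GRing.Theory Num.Theory.
Local Open Scope classical_set_scope.
Local Open Scope ring_scope.

Record sgraph := SGraph {
  vertex :> finType;
  adj : rel vertex;
  adj_sym : symmetric adj;
  adj_irr : irreflexive adj }.

(* In the suffixes, p (+) marks an included and m (-) an excluded endpoint,   *)
(* left endpoint first.                                                       *)
Definition Upp (R : realType) : set (set R) :=
  [set J | exists x : R, J = `[x, x + 1]%classic].
Definition Umm (R : realType) : set (set R) :=
  [set J | exists x : R, J = `]x, x + 1[%classic].
Definition Ump (R : realType) : set (set R) :=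
  [set J | exists x : R, J = `]x, x + 1]%classic].
Definition Upm (R : realType) : set (set R) :=
  [set J | exists x : R, J = `[x, x + 1[%classic].

Arguments Upp : clear implicits.
Arguments Umm : clear implicits.
Arguments Ump : clear implicits.
Arguments Upm : clear implicits.

Definition interval_graph (R : realType) (N : set (set R)) (G : sgraph) : Prop :=
  exists I : G -> set R,
    (forall v : G, N (I v)) /\
    (forall u v : G, u != v -> (adj u v <-> I u `&` I v !=set0)).

(* Main.v *)
(** Two unit intervals starting at [x] and [y] meet iff [y < x + 1] and
    [x < y + 1], where [y = x + 1] is also allowed when the two endpoints that
    touch there are both included (and symmetrically).  Hence only pairs with
    [y = x + 1] are sensitive to the types of the intervals, and moving every
    left endpoint [x v] to [x v + e * d v], for a small [e > 0], keeps the
    graph while changing all types, provided [d v - d u] has the right sign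
    whenever [x v = x u + 1].  With [m] exceeding all [|x v|], the following
    [d] make every interval closed:
    - if no interval is open, [0] for closed, [x - m] for closed-open and
      [x + m] for open-closed intervals;
    - if no interval is closed, [x] for closed-open, [x + 1/2] for open and
      [x + 1] for open-closed intervals.
    Conversely [d = - x] turns closed intervals into half-open ones. *)
Require Import Defs.
From mathcomp Require Import all_boot all_order all_algebra.
From mathcomp Require Import mathcomp_extra boolp classical_sets set_interval reals.
From mathcomp Require Import lra.
Local Open Scope classical_set_scope.
Import Order.TTheory GRing.Theory Num.Theory.
Local Open Scope ring_scope.

(* [l] and [r] tell whether the left and right endpoints are included. *)
Definition unit_itv {R : realType} (l r : bool) (x : R) : set R :=
  [set` Interval (BSide l x) (BSide (~~ r) (x + 1))].

Definition unit_family (R : realType) (P : bool -> bool -> bool) : set (set R) :=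
  [set J | exists l r x, P l r /\ J = unit_itv l r x].

Lemma unit_itv_meet (R : realType) (l r l' r' : bool) (x y : R) :
  unit_itv l r x `&` unit_itv l' r' y !=set0 <->
  (y < x + 1 ?<= if r && l') && (x < y + 1 ?<= if r' && l).
Proof.
rewrite /unit_itv; split.
  case=> z [] /=; rewrite !itv_boundlr => /andP[xz zx] /andP[yz zy].
  move: xz zx yz zy.
  by case: l r l' r' => [] [] [] [] /=; rewrite !bnd_simp /Order.lteif /=;
    move=> *; apply/andP; split; lra.
(* The midpoint of the intersection; for touching intervals, their common endpoint. *)
case/andP=> yx xy; exists ((x + y + 1) / 2); split; move: yx xy => /=;
  rewrite itv_boundlr; case: l r l' r' => [] [] [] [] /=;
  rewrite !bnd_simp /Order.lteif /= => yx xy; apply/andP; split; lra.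
Qed.

(** Each quotient [|g i| / f i] is at most the sum of all of them, so the inverse of [1] plus that
    sum serves every [i] at once. *)
Lemma finite_small_factor (R : realFieldType) (I : finType) (f g : I -> R) :
  (forall i, 0 < f i) -> exists2 e, 0 < e & forall i, e * `|g i| < f i.
Proof.
move=> f0; pose S := \sum_i `|g i| / f i.
have q0 i : 0 <= `|g i| / f i by rewrite divr_ge0 // ltW.
have S0 : 0 <= S by apply: sumr_ge0.
have S1 : 0 < 1 + S by lra.
exists (1 + S)^-1 => [|i]; first by rewrite invr_gt0.
rewrite mulrC ltr_pdivrMr // mulrC -ltr_pdivrMr //.
have -> : S = `|g i| / f i + \sum_(j | j != i) `|g j| / f j.
  by rewrite /S (bigD1 i).
have : 0 <= \sum_(j | j != i) `|g j| / f j by apply: sumr_ge0.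
lra.
Qed.

Lemma perturb_left_endpoints (R : realFieldType) (T : finType) (x d : T -> R)
    (c c' : T -> T -> bool) :
  (forall u v, x v = x u + 1 -> (d v < d u ?<= if c' u v) = c u v) ->
  exists e, forall u v,
    (x v + e * d v < x u + e * d u + 1 ?<= if c' u v) =
    (x v < x u + 1 ?<= if c u v).
Proof.
move=> cc'; pose gap (p : T * T) := x p.2 - x p.1 - 1.
(* At gap [0] any [e > 0] will do; the value [1] merely keeps [f] positive. *)
pose f p := if gap p == 0 then 1 else `|gap p|.
have f0 p : 0 < f p by rewrite /f; case: eqVneq => //; rewrite normr_gt0.
have [e e0 he] :=
  @finite_small_factor R (T * T)%type f (fun p => d p.2 - d p.1) f0.
exists e => u v; have := he (u, v); rewrite /f /gap /=.
rewrite -[in e * _](gtr0_norm e0) -normrM mulrBr.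
case: eqVneq => [x1 _|_].
  have xvu : x v = x u + 1 by lra.
  rewrite -(cc' _ _ xvu) xvu; case: (c' u v) => /=.
    have -> : (x u + 1 + e * d v <= x u + e * d u + 1) = (e * d v <= e * d u).
      by apply/idP/idP; lra.
    by rewrite ler_pM2l //; case: (d v <= d u); rewrite /= ?lexx ?ltxx.
  have -> : (x u + 1 + e * d v < x u + e * d u + 1) = (e * d v < e * d u).
    by apply/idP/idP; lra.
  by rewrite ltr_pM2l //; case: (d v < d u); rewrite /= ?lexx ?ltxx.
(* The shift changes a nonzero gap by less than its absolute value, so its sign survives. *)
rewrite ltr_norml => /andP[].
case: (ltrgt0P (x v - x u - 1)) => h h1 h2; last by lra.
- by rewrite /Order.lteif; case: (c u v); case: (c' u v); apply/idP/idP; lra.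
- by rewrite /Order.lteif; case: (c u v); case: (c' u v); apply/idP/idP; lra.
Qed.

Lemma interval_graph_sub {R : realType} {N N' : set (set R)} {G : sgraph} :
  N `<=` N' -> interval_graph N G -> interval_graph N' G.
Proof. by move=> NN' [I [NI adjI]]; exists I; split=> // v; apply: NN'. Qed.

Lemma unit_family_retype (R : realType) (P : bool -> bool -> bool) (l' r' : bool)
    (G : sgraph) :
  (forall (l r : G -> bool) (x : G -> R), (forall v, P (l v) (r v)) ->
     exists d : G -> R, forall u v, x v = x u + 1 ->
       (d v < d u ?<= if r' && l') = r u && l v) ->
  interval_graph (unit_family R P) G ->
  interval_graph [set J | exists x : R, J = unit_itv l' r' x] G.
Proof.
move=> hd [I [NI adjI]].
have {NI} /choice[p hp] : forall v, exists p : bool * bool * R,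
    P p.1.1 p.1.2 /\ I v = unit_itv p.1.1 p.1.2 p.2.
  by move=> v; have [l [r [x h]]] := NI v; exists (l, r, x).
pose x v := (p v).2.
have [d hd'] := hd (fun v => (p v).1.1) (fun v => (p v).1.2) x
  (fun v => (hp v).1).
have [e he] := @perturb_left_endpoints R G x d
  (fun u v => (p u).1.2 && (p v).1.1) (fun _ _ => r' && l') hd'.
exists (fun v => unit_itv l' r' (x v + e * d v)); split=> [v|u v uv].
  by exists (x v + e * d v).
rewrite (adjI _ _ uv) (hp u).2 (hp v).2.
split=> /unit_itv_meet h; apply/unit_itv_meet; move: h; rewrite -/(x u) -/(x v).
  by rewrite !he.
by rewrite !he.
Qed.

Lemma no_open_closed (R : realType) (G : sgraph) :
  interval_graph (Upp R `|` Upm R `|` Ump R) G -> interval_graph (Upp R) G.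
Proof.
move=> h; apply: (@unit_family_retype R orb true true G); last first.
  apply: interval_graph_sub h => J [[]|] [x ->].
  - by exists true, true, x.
  - by exists true, false, x.
  - by exists false, true, x.
move=> l r x lr; pose m := 1 + \sum_v `|x v|.
have hm v : -m < x v < m.
  rewrite -ltr_norml /m (bigD1 v) //=.
  have : 0 <= \sum_(j | j != v) `|x j| by apply: sumr_ge0.
  lra.
(* By [hm], [d] is negative on closed-open and positive on open-closed intervals; within either type
   it grows with [x], so touching intervals of that type are driven apart. *)
exists (fun v => if l v && r v then 0 else if l v then x v - m else x v + m).
move=> u v; have /andP[] := hm u; have /andP[] := hm v.
case: (l u) (r u) (l v) (r v) (lr u) (lr v) => [] [] [] [] //= _ _ *;
  apply/idP/idP => //; lra.
Qed.

Lemma no_closed_closed (R : realType) (G : sgraph) :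
  interval_graph (Umm R `|` Upm R `|` Ump R) G -> interval_graph (Upp R) G.
Proof.
move=> h; apply: (@unit_family_retype R (fun l r => ~~ (l && r)) true true G);
  last first.
  apply: interval_graph_sub h => J [[]|] [x ->].
  - by exists false, false, x.
  - by exists true, false, x.
  - by exists false, true, x.
move=> l r x lr.
(* A touching pair meets only if [u] is open-closed and [v] closed-open, and then [d v = d u]; in
   all other cases [d v - d u] is at least [1 / 2]. *)
exists (fun v => x v + if r v then 1 else if l v then 0 else 1 / 2).
move=> u v; case: (l u) (r u) (l v) (r v) (lr u) (lr v) => [] [] [] [] //= _ _ *;
  apply/idP/idP => //; lra.
Qed.

Lemma closed_not_closed (R : realType) (l' r' : bool) (G : sgraph) :
  ~~ (r' && l') -> interval_graph (Upp R) G ->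
  interval_graph [set J | exists x : R, J = unit_itv l' r' x] G.
Proof.
move=> rl h; apply: (@unit_family_retype R andb l' r' G); last first.
  by apply: interval_graph_sub h => J [x ->]; exists true, true, x.
(* Here [d v = d u - 1], so touching closed intervals are pushed into a proper overlap. *)
move=> l r x lr; exists (fun v => - x v) => u v ->.
have /andP[_ ->] := lr u; have /andP[-> _] := lr v.
by rewrite (negbTE rl) /=; lra.
Qed.

Theorem theorem5 (R : realType) (G : sgraph) :
  (interval_graph (Upp R `|` Upm R) G <-> interval_graph (Upp R) G) /\
  (interval_graph (Upp R `|` Ump R) G <-> interval_graph (Upp R) G) /\
  (interval_graph (Umm R `|` Upm R) G <-> interval_graph (Upp R) G) /\
  (interval_graph (Umm R `|` Ump R) G <-> interval_graph (Upp R) G) /\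
  (interval_graph (Upp R `|` Upm R `|` Ump R) G <-> interval_graph (Upp R) G) /\
  (interval_graph (Umm R `|` Upm R `|` Ump R) G <-> interval_graph (Upp R) G).
Proof.
(* These give the converse for the families without closed intervals, each of which contains a
   half-open one. *)
have pm : interval_graph (Upp R) G -> interval_graph (Upm R) G.
  exact: (@closed_not_closed R true false).
have mp : interval_graph (Upp R) G -> interval_graph (Ump R) G.
  exact: (@closed_not_closed R false true).
do !split.
- by move=> h; apply: no_open_closed; apply: interval_graph_sub h => J; left.
- by apply: interval_graph_sub => J; left.
- by move=> h; apply: no_open_closed; apply: interval_graph_sub h => J [];
    [left; left | right].
- by apply: interval_graph_sub => J; left.
- by move=> h; apply: no_closed_closed; apply: interval_graph_sub h => J; left.
- by move/pm; apply: interval_graph_sub => J; right.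
- by move=> h; apply: no_closed_closed; apply: interval_graph_sub h => J [];
    [left; left | right].
- by move/mp; apply: interval_graph_sub => J; right.
- exact: no_open_closed.
- by apply: interval_graph_sub => J; left; left.
- exact: no_closed_closed.
- by move/pm; apply: interval_graph_sub => J; left; right.
Qed.
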